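(* Let $\Lambda=\{\Lambda_n\}_{n\ge0}$ be a sequence of real numbers, and let $0<b<a$, where $b$ is not an integer. If $(1-\nabla)^a\Lambda_n\ge0$ for every $n\ge0$ and $(1-\nabla)^b\Lambda$ is well defined, then $(1-\nabla)^b\Lambda_n\ge0$ for every $n\ge0$.
   Context: For $a\in\mathbb{R}$, $k^{-a}(j)$ denotes the $j$-th Taylor coefficient at the origin of $(1-t)^a$. For a real sequence $\Lambda$, $(1-\nabla)^a\Lambda$ is the sequence with $n$-th term $(1-\nabla)^a\Lambda_n:=\sum_{j=0}^\infty k^{-a}(j)\Lambda_{j+n}$; it is well defined if this series converges for every $n\ge0$. The hypothesis $(1-\nabla)^a\Lambda_n\ge0$ for all $n$ includes that $(1-\nabla)^a\Lambda$ is well defined. *)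

(* Defs.v *)
From Stdlib Require Import Arith ZArith Reals.
From Coquelicot Require Import Coquelicot.

Local Open Scope R_scope.

Definition taylor_coef (f : R -> R) (j : nat) : R :=
  Derive_n f j 0 / INR (fact j).

(* [kneg a] is the kernel written k^{-a}. Only the values of [Rpower] near
   1 matter here, where [Rpower (1 - t) a] is the usual (1 - t)^a. *)
Definition kneg (a : R) (j : nat) : R :=
  taylor_coef (fun t => Rpower (1 - t) a) j.

Definition fracdiff_term (a : R) (L : nat -> R) (n j : nat) : R :=
  kneg a j * L (j + n)%nat.

Definition fracdiff_defined (a : R) (L : nat -> R) : Prop :=
  forall n : nat, ex_series (fracdiff_term a L n).

(* (1 - nabla)^a L; it is meaningful only when [fracdiff_defined a L] holds,
   since [Series] returns a default value on divergent series. *)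
Definition fracdiff (a : R) (L : nat -> R) (n : nat) : R :=
  Series (fracdiff_term a L n).

Definition fracdiff_nonneg (a : R) (L : nat -> R) : Prop :=
  fracdiff_defined a L /\ forall n : nat, 0 <= fracdiff a L n.

(* Main.v *)
(** Since [(1 - nabla)^(b + 1) = (1 - nabla)^b - shift (1 - nabla)^b], unit
    steps from [b] reduce to [d = a - b <= 1]. Formally
    [(1 - nabla)^b L = (1 - nabla)^(- d) f] with [f = (1 - nabla)^a L >= 0], and
    [(1 - t)^(- d)] has positive coefficients, but neither side converges well
    enough to compose the operators. Truncate [(1 - t)^(- d)] by the Cesaro
    weights of order exactly [b]: the product of the truncation of length [N]
    with [(1 - t)^a] has, by the Pfaff-Saalschuetz identity, coefficients
    [c_m h (N - m) / h N], where [c_m] are the coefficients of [(1 - t)^b] and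
    [h x] is a multiple of Gamma (x + b + 1) / Gamma (x + a + 1). Averaging over
    [N <= M] with weights [h N] makes the multipliers of [c_m] telescope: they
    tend to 1 for fixed [m] (as the sum of [h] diverges for [d <= 1]), with
    total variation in [m] bounded uniformly in [M]. Summation by parts then
    handles the merely conditionally convergent series of [(1 - nabla)^b L]. *)

Require Import Defs.
From Stdlib Require Import Arith ZArith Reals Lra Lia.
From Coquelicot Require Import Coquelicot.

Local Open Scope R_scope.

(** * Taylor coefficients of (1 - t)^a as signed binomial coefficients *)

Fixpoint binc (a : R) (j : nat) : R :=
  match j with
  | O => 1
  | S i => binc a i * (INR i - a) / INR (S i)
  end.

Lemma binc_rec (a : R) (i : nat) :
  INR (S i) * binc a (S i) = (INR i - a) * binc a i.
Proof.
  cbn [binc]. field. apply not_0_INR. lia.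
Qed.

Lemma Derive_n_Rpower (a : R) (j : nat) (t : R) : t < 1 ->
  Derive_n (fun s => Rpower (1 - s) a) j t
  = INR (fact j) * binc a j * Rpower (1 - t) (a - INR j).
Proof.
  revert t. induction j as [|j IH]; intros t Ht.
  - simpl. rewrite Rminus_0_r. ring.
  - cbn [Derive_n].
    rewrite (Derive_ext_loc _
      (fun s => INR (fact j) * binc a j * Rpower (1 - s) (a - INR j))).
    2:{ assert (He : 0 < 1 - t) by lra.
        exists (mkposreal _ He). intros s Hs. apply IH.
        change (Rabs (s - t) < 1 - t) in Hs.
        apply Rabs_def2 in Hs. lra. }
    apply is_derive_unique. unfold Rpower.
    auto_derive; [lra|].
    replace ((a - INR (S j)) * ln (1 - t))
      with ((a - INR j) * ln (1 + - t) + - ln (1 - t))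
      by (rewrite S_INR; unfold Rminus; ring).
    rewrite exp_plus, exp_Ropp, exp_ln by lra.
    rewrite fact_simpl, mult_INR.
    replace (INR (S j) * INR (fact j) * binc a (S j))
      with (INR (fact j) * ((INR j - a) * binc a j))
      by (rewrite <- binc_rec; ring).
    field. lra.
Qed.

Lemma kneg_binc (a : R) (j : nat) : kneg a j = binc a j.
Proof.
  unfold kneg, taylor_coef. rewrite Derive_n_Rpower by lra.
  rewrite Rminus_0_r. unfold Rpower. rewrite ln_1, Rmult_0_r, exp_0.
  field. apply INR_fact_neq_0.
Qed.

(** * Summation by parts against multipliers of bounded variation *)

Lemma sum_lag_telescope (r : nat -> R) (K : nat) :
  sum_f_R0 (fun m => r (S m) - r m) K = r (S K) - r O.
Proof.
  induction K as [|K IH]; cbn [sum_f_R0]; [ring | rewrite IH; ring].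
Qed.

Lemma Rabs_le_variation (r : nat -> R) (K : nat) :
  Rabs (r (S K)) <= Rabs (r O) + sum_f_R0 (fun m => Rabs (r (S m) - r m)) K.
Proof.
  replace (r (S K)) with (r O + sum_f_R0 (fun m => r (S m) - r m) K)
    by (rewrite sum_lag_telescope; ring).
  eapply Rle_trans; [apply Rabs_triang|].
  apply Rplus_le_compat_l, Rsum_abs.
Qed.

Lemma sum_initial_le (D : R) (m0 K : nat) : 0 <= D ->
  sum_f_R0 (fun m => if (m <? m0)%nat then D else 0) K <= D * INR m0.
Proof.
  intros HD.
  assert (H : sum_f_R0 (fun m => if (m <? m0)%nat then D else 0) K
              <= D * INR (Nat.min (S K) m0)).
  { induction K as [|K IH]; cbn [sum_f_R0].
    - destruct (Nat.ltb_spec 0 m0).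
      + rewrite Nat.min_l by lia. simpl. lra.
      + rewrite Nat.min_r by lia. pose proof (pos_INR m0). nra.
    - destruct (Nat.ltb_spec (S K) m0).
      + rewrite Nat.min_l in * by lia. rewrite (S_INR (S K)). lra.
      + rewrite Nat.min_r in * by lia. lra. }
  eapply Rle_trans; [exact H|].
  apply Rmult_le_compat_l; [exact HD|]. apply le_INR. lia.
Qed.

(** Abel summation against the tails [G - sum_f_R0 u m], which tend to 0 when [u] sums to [G]; this
    isolates the main term [r O * G]. *)
Lemma summation_by_parts (r u : nat -> R) (G : R) (K : nat) :
  sum_f_R0 (fun m => r m * u m) K
  = r O * G + sum_f_R0 (fun m => (r (S m) - r m) * (G - sum_f_R0 u m)) K
    - r (S K) * (G - sum_f_R0 u K).
Proof.
  induction K as [|K IH]; cbn [sum_f_R0] in *; [ring|].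
  rewrite IH. ring.
Qed.

(** If [G < 0], summation by parts bounds [s] by [r M O * G] plus errors: the tails beyond some [m0]
    are small against a variation of order [r M O], and the first [m0] increments cost an amount
    independent of [M]. For large [r M O] the main term wins and [s < 0]. *)
Lemma sum_nonneg_of_means (r : nat -> nat -> R) (u : nat -> R) (G C D : R) :
  is_series u G ->
  (forall M, 0 < r M O) ->
  (forall E, exists M, E < r M O) ->
  (forall M m, Rabs (r M (S m) - r M m) <= D) ->
  (forall M K, sum_f_R0 (fun m => Rabs (r M (S m) - r M m)) K <= C * r M O) ->
  (forall M, exists2 s, 0 <= s & is_series (fun m => r M m * u m) s) ->
  0 <= G.
Proof.
  intros Hu Hpos Hunb HD HC Hs.
  apply Rnot_lt_le. intros HG.
  assert (HD0 : 0 <= D).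
  { eapply Rle_trans; [apply Rabs_pos | apply (HD O O)]. }
  assert (HC0 : 0 <= C).
  { specialize (HC O O). specialize (Hpos O). cbn [sum_f_R0] in HC.
    pose proof (Rabs_pos (r O 1%nat - r O 0%nat)). nra. }
  assert (HA : is_lim_seq (fun m => G - sum_f_R0 u m) 0).
  { replace (Finite 0) with (Finite (G - G)) by (f_equal; ring).
    apply is_lim_seq_minus'; [apply is_lim_seq_const|].
    apply (is_lim_seq_ext (sum_n u)); [apply sum_n_Reals | exact Hu]. }
  destruct (maj_by_pos (fun m => G - sum_f_R0 u m)) as [B [HB0 HB]].
  { exists 0. apply is_lim_seq_Reals. exact HA. }
  (* With [Z] standing for [r M O], the small-tail errors [eps * (C * Z)] and [(Z + C * Z) * eps]
     then use up exactly half of [- G * Z]. *)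
  pose (eps := - G / (2 * (1 + 2 * C))).
  assert (Heps : 0 < eps) by (apply Rdiv_lt_0_compat; lra).
  apply is_lim_seq_spec in HA.
  destruct (HA (mkposreal eps Heps)) as [m0 Hm0]. simpl in Hm0.
  assert (Htail : forall m, (m0 <= m)%nat -> Rabs (G - sum_f_R0 u m) <= eps).
  { intros m Hm. specialize (Hm0 m Hm). rewrite Rminus_0_r in Hm0. lra. }
  (* This [M] makes the other half exceed the cost [D * B * INR m0] of the first [m0] increments. *)
  destruct (Hunb (2 * (D * B * INR m0) / - G)) as [M HM].
  destruct (Hs M) as [s Hs0 HsM].
  set (Z := r M O) in *.
  assert (HZ : 0 < Z) by apply Hpos.
  assert (Hle : s <= Z * G + (eps * (C * Z) + D * B * INR m0)
                     + (Z + C * Z) * eps).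
  { change (Rbar_le s (Z * G + (eps * (C * Z) + D * B * INR m0)
                     + (Z + C * Z) * eps)).
    apply (is_lim_seq_le_loc (sum_f_R0 (fun m => r M m * u m))
      (fun _ => Z * G + (eps * (C * Z) + D * B * INR m0)
                     + (Z + C * Z) * eps));
      [| | apply is_lim_seq_const].
    2:{ eapply is_lim_seq_ext; [|exact HsM]. intros K. apply sum_n_Reals. }
    exists m0. intros K HK. rewrite (summation_by_parts _ _ G). fold Z.
    assert (H1 : sum_f_R0 (fun m => (r M (S m) - r M m) * (G - sum_f_R0 u m)) K
                 <= eps * (C * Z) + D * B * INR m0).
    { apply Rle_trans with (sum_f_R0 (fun m => Rabs (r M (S m) - r M m) * eps
         + (if (m <? m0)%nat then D * B else 0)) K).
      - apply sum_Rle. intros m _.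
        eapply Rle_trans; [apply Rle_abs|]. rewrite Rabs_mult.
        pose proof (Rabs_pos (r M (S m) - r M m)) as Hp.
        destruct (Nat.ltb_spec m m0).
        + pose proof (Rmult_le_compat _ _ _ _ Hp
            (Rabs_pos (G - sum_f_R0 u m)) (HD M m) (HB m)). nra.
        + rewrite Rplus_0_r. apply Rmult_le_compat_l; [exact Hp|].
          apply Htail. lia.
      - rewrite plus_sum. apply Rplus_le_compat.
        + rewrite <- scal_sum. apply Rmult_le_compat_l; [lra | apply HC].
        + apply sum_initial_le. nra. }
    assert (H2 : - (r M (S K) * (G - sum_f_R0 u K)) <= (Z + C * Z) * eps).
    { eapply Rle_trans; [apply Rle_abs|]. rewrite Rabs_Ropp, Rabs_mult.
      apply Rmult_le_compat; [apply Rabs_pos | apply Rabs_pos | | apply Htail; exact HK].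
      eapply Rle_trans; [apply Rabs_le_variation|].
      apply Rplus_le_compat; [|apply HC].
      fold Z. rewrite Rabs_pos_eq; lra. }
    lra. }
  assert (He : eps * (C * Z) + (Z + C * Z) * eps = - G * Z / 2)
    by (unfold eps; field; lra).
  assert (HZ2 : 2 * (D * B * INR m0) < - G * Z).
  { apply (Rmult_lt_compat_l (- G)) in HM; [|lra].
    replace (- G * (2 * (D * B * INR m0) / - G))
      with (2 * (D * B * INR m0)) in HM by (field; lra). exact HM. }
  nra.
Qed.

(** * Quotients (p)_k / (q)_k of rising factorials *)

Fixpoint rising_ratio (p q : R) (k : nat) : R :=
  match k with
  | O => 1
  | S i => rising_ratio p q i * (INR i + p) / (INR i + q)
  end.

Lemma rising_ratio_pos (p q : R) (k : nat) : 0 < p -> 0 < q ->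
  0 < rising_ratio p q k.
Proof.
  intros Hp Hq. induction k as [|k IH]; cbn [rising_ratio]; [lra|].
  pose proof (pos_INR k).
  apply Rdiv_lt_0_compat; [apply Rmult_lt_0_compat|]; lra.
Qed.

Lemma rising_ratio_le_1 (p q : R) (k : nat) : 0 < p -> p <= q ->
  rising_ratio p q k <= 1.
Proof.
  intros Hp Hq. induction k as [|k IH]; cbn [rising_ratio]; [lra|].
  pose proof (pos_INR k).
  pose proof (rising_ratio_pos p q k Hp ltac:(lra)).
  apply Rle_div_l; nra.
Qed.

(** The bound is the case [q = p + 1], where the product telescopes; a smaller [q] only enlarges
    each factor. *)
Lemma rising_ratio_lower (p q : R) (k : nat) : 0 < p -> 0 < q -> q <= p + 1 ->
  p / (INR k + p) <= rising_ratio p q k.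
Proof.
  intros Hp Hq Hpq. induction k as [|k IH]; cbn [rising_ratio].
  - simpl. apply Rle_div_l; lra.
  - pose proof (pos_INR k).
    apply Rle_trans with (p / (INR k + p) * (INR k + p) / (INR k + q)).
    + replace (p / (INR k + p) * (INR k + p)) with p by (field; lra).
      apply Rmult_le_compat_l; [lra|].
      apply Rinv_le_contravar; [lra|]. rewrite S_INR. lra.
    + apply Rmult_le_compat_r; [left; apply Rinv_0_lt_compat; lra|].
      apply Rmult_le_compat_r; [lra | exact IH].
Qed.

Lemma ln_succ_le (x : R) : 0 < x -> ln (x + 1) - ln x <= / x.
Proof.
  intros Hx. rewrite <- ln_div by lra.
  rewrite <- (ln_exp (/ x)).
  apply ln_le; [apply Rdiv_lt_0_compat; lra|].
  replace ((x + 1) / x) with (1 + / x) by (field; lra).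
  apply exp_ineq1_le.
Qed.

(** Comparison with the harmonic series, hence with [ln]. For [p = b + 1] and [q = a + 1] the last
    condition reads [a <= b + 1], which is why the theorem descends in unit steps. *)
Lemma sum_rising_ratio_unbounded (p q E : R) : 1 <= p -> 0 < q -> q <= p + 1 ->
  exists n, E < sum_f_R0 (rising_ratio p q) n.
Proof.
  intros Hp Hq Hpq.
  assert (H : forall n,
    ln (INR n + 1 + p) - ln p <= sum_f_R0 (rising_ratio p q) n).
  { assert (Hstep : forall k,
      ln (INR k + p + 1) - ln (INR k + p) <= rising_ratio p q k).
    { intros k. pose proof (pos_INR k).
      eapply Rle_trans; [apply ln_succ_le; lra|].
      eapply Rle_trans; [|apply rising_ratio_lower; lra].
      pose proof (Rinv_0_lt_compat (INR k + p) ltac:(lra)).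
      unfold Rdiv. nra. }
    induction n as [|n IH]; cbn [sum_f_R0].
    - specialize (Hstep O). simpl INR in *. rewrite !Rplus_0_l in *.
      rewrite (Rplus_comm 1 p). exact Hstep.
    - specialize (Hstep (S n)). rewrite S_INR in *.
      replace (INR n + 1 + 1 + p) with (INR n + 1 + p + 1) by ring. lra. }
  destruct (INR_unbounded (exp (E + ln p))) as [n Hn].
  exists n. specialize (H n).
  assert (E + ln p < ln (INR n + 1 + p)).
  { rewrite <- (ln_exp (E + ln p)). apply ln_increasing; [apply exp_pos | lra]. }
  lra.
Qed.

Lemma nat_not_int (b : R) (i : nat) :
  (~ exists z : Z, b = IZR z) -> INR i + - b <> 0.
Proof.
  intros hbZ H. apply hbZ. exists (Z.of_nat i). rewrite <- INR_IZR_INZ. lra.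
Qed.

(** From [k > a] on, (k - a) / (k - b) <= (k + b + 1) / (k + a + 1) because a (a + 1) >= b (b + 1);
    [C] absorbs the finitely many earlier indices. *)
Lemma rising_ratio_reflect_le (a b : R) :
  0 < b -> b < a -> (~ exists z : Z, b = IZR z) ->
  exists2 C, 0 < C &
    forall k, Rabs (rising_ratio (- a) (- b) k)
              <= C * rising_ratio (b + 1) (a + 1) k.
Proof.
  intros hb hba hbZ.
  pose proof (fun k => rising_ratio_pos (b + 1) (a + 1) k
                ltac:(lra) ltac:(lra)) as Hpos.
  assert (Hinit : forall n, exists2 C, 0 < C & forall k, (k <= n)%nat ->
     Rabs (rising_ratio (- a) (- b) k) <= C * rising_ratio (b + 1) (a + 1) k).
  { induction n as [|n [C HC IH]].
    - exists 1; [lra|]. intros k Hk. replace k with O by lia. simpl.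
      rewrite Rabs_R1. lra.
    - exists (Rmax C (Rabs (rising_ratio (- a) (- b) (S n))
                      / rising_ratio (b + 1) (a + 1) (S n))).
      + eapply Rlt_le_trans; [exact HC | apply Rmax_l].
      + intros k Hk. apply Rle_div_l; [apply Hpos|].
        destruct (Nat.eq_dec k (S n)) as [->|Hne]; [apply Rmax_r|].
        eapply Rle_trans; [|apply Rmax_l].
        apply <- Rle_div_l; [|apply Hpos]. apply IH. lia. }
  destruct (INR_unbounded a) as [n Hn].
  destruct (Hinit n) as [C HC HCn].
  assert (Htail : forall i,
    Rabs (rising_ratio (- a) (- b) (n + i))
    <= C * rising_ratio (b + 1) (a + 1) (n + i)).
  { induction i as [|i IH]; [rewrite Nat.add_0_r; apply HCn; lia|].
    rewrite Nat.add_succ_r. cbn [rising_ratio].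
    set (k := (n + i)%nat) in *.
    assert (Hk : a < INR k).
    { apply Rlt_le_trans with (INR n); [lra|]. apply le_INR. unfold k. lia. }
    replace (rising_ratio (- a) (- b) k * (INR k + - a) / (INR k + - b))
      with (rising_ratio (- a) (- b) k * ((INR k - a) / (INR k - b)))
      by (field; lra).
    replace (C * (rising_ratio (b + 1) (a + 1) k * (INR k + (b + 1))
                  / (INR k + (a + 1))))
      with (C * rising_ratio (b + 1) (a + 1) k
              * ((INR k + b + 1) / (INR k + a + 1)))
      by (field; lra).
    assert (Hq : 0 <= (INR k - a) / (INR k - b))
      by (apply Rdiv_le_0_compat; lra).
    rewrite Rabs_mult, (Rabs_pos_eq _ Hq).
    apply Rmult_le_compat; [apply Rabs_pos | exact Hq | exact IH |].
    apply Rle_div_l; [lra|].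
    replace ((INR k + b + 1) / (INR k + a + 1) * (INR k - b))
      with ((INR k + b + 1) * (INR k - b) / (INR k + a + 1)) by (field; lra).
    apply Rle_div_r; [lra|]. nra. }
  exists C; [exact HC|]. intros k.
  destruct (le_lt_dec k n) as [Hk|Hk]; [apply HCn; exact Hk|].
  replace k with (n + (k - n))%nat by lia. apply Htail.
Qed.

(** From [k > a] on, the factors (k - a) / (k - b) lie between 0 and 1, so the sign [sg] is frozen
    and the size decreases. This lets the far variation of [gamma_mean] telescope. *)
Lemma rising_ratio_reflect_monotone (a b : R) : 0 < b -> b < a ->
  exists k0 sg, (sg = 1 \/ sg = -1) /\
    forall k, (k0 <= k)%nat ->
      0 <= sg * rising_ratio (- a) (- b) (S k)
        <= sg * rising_ratio (- a) (- b) k.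
Proof.
  intros hb hba.
  destruct (INR_unbounded a) as [k0 Hk0].
  assert (Hsg : exists sg, (sg = 1 \/ sg = -1) /\
                  0 <= sg * rising_ratio (- a) (- b) k0).
  { destruct (Rle_dec 0 (rising_ratio (- a) (- b) k0)).
    - exists 1. split; [left; reflexivity | lra].
    - exists (-1). split; [right; reflexivity | lra]. }
  destruct Hsg as [sg [Hsg H0]]. exists k0, sg. split; [exact Hsg|].
  assert (Hstep : forall k, (k0 <= k)%nat ->
    0 <= sg * rising_ratio (- a) (- b) k ->
    0 <= sg * rising_ratio (- a) (- b) (S k)
      <= sg * rising_ratio (- a) (- b) k).
  { intros k Hk H. cbn [rising_ratio].
    assert (Hak : a < INR k).
    { apply Rlt_le_trans with (INR k0); [lra | apply le_INR; exact Hk]. }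
    replace (sg * (rising_ratio (- a) (- b) k * (INR k + - a) / (INR k + - b)))
      with (sg * rising_ratio (- a) (- b) k * ((INR k - a) / (INR k - b)))
      by (field; lra).
    assert (0 <= (INR k - a) / (INR k - b))
      by (apply Rdiv_le_0_compat; lra).
    assert ((INR k - a) / (INR k - b) <= 1) by (apply Rle_div_l; lra).
    split; nra. }
  assert (Hnn : forall i, 0 <= sg * rising_ratio (- a) (- b) (k0 + i)).
  { induction i as [|i IH]; [rewrite Nat.add_0_r; exact H0|].
    rewrite Nat.add_succ_r. apply Hstep; [lia | exact IH]. }
  intros k Hk. apply Hstep; [exact Hk|].
  replace k with (k0 + (k - k0))%nat by lia. apply Hnn.
Qed.

(** * The Gamma quotient on the integers *)

(* The solution of [(x + b + 1) h x = (x + a + 1) h (x + 1)], [h 0 = 1], on the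
   integers: a multiple of Gamma (x + b + 1) / Gamma (x + a + 1). *)
Definition gamma_ratio (a b : R) (x : Z) : R :=
  if (0 <=? x)%Z then rising_ratio (b + 1) (a + 1) (Z.to_nat x)
  else rising_ratio (- a) (- b) (Z.to_nat (- x)).

Lemma gamma_ratio_pos (a b : R) (k : nat) :
  gamma_ratio a b (Z.of_nat k) = rising_ratio (b + 1) (a + 1) k.
Proof.
  unfold gamma_ratio. destruct (Z.leb_spec 0 (Z.of_nat k)); [|lia].
  now rewrite Nat2Z.id.
Qed.

Lemma gamma_ratio_neg (a b : R) (k : nat) :
  gamma_ratio a b (- Z.of_nat k) = rising_ratio (- a) (- b) k.
Proof.
  destruct k as [|k]; [reflexivity|]. unfold gamma_ratio.
  destruct (Z.leb_spec 0 (- Z.of_nat (S k))); [lia|].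
  now rewrite Z.opp_involutive, Nat2Z.id.
Qed.

(** For negative [x = - k - 1] this is the step of [rising_ratio (- a) (- b)] read downwards; its
    denominator k - b is nonzero since [b] is not an integer. *)
Lemma gamma_ratio_rec (a b : R) (x : Z) :
  0 < b -> b < a -> (~ exists z : Z, b = IZR z) ->
  (IZR x + b + 1) * gamma_ratio a b x
  = (IZR x + a + 1) * gamma_ratio a b (x + 1).
Proof.
  intros hb hba hbZ. destruct (Z.leb_spec 0 x) as [Hx|Hx].
  - destruct (Z_of_nat_complete x Hx) as [k ->].
    replace (Z.of_nat k + 1)%Z with (Z.of_nat (S k)) by lia.
    rewrite !gamma_ratio_pos, <- INR_IZR_INZ. cbn [rising_ratio].
    pose proof (pos_INR k). field. lra.
  - destruct (Z_of_nat_complete (- (x + 1))) as [k Hk]; [lia|].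
    replace x with (- Z.of_nat (S k))%Z at 2 by lia.
    replace (x + 1)%Z with (- Z.of_nat k)%Z by lia.
    replace x with (- Z.of_nat k - 1)%Z by lia.
    rewrite !gamma_ratio_neg, minus_IZR, opp_IZR, <- INR_IZR_INZ.
    cbn [rising_ratio]. field. apply (nat_not_int b k hbZ).
Qed.

Lemma gamma_ratio_bounded (a b : R) :
  0 < b -> b < a -> (~ exists z : Z, b = IZR z) ->
  exists2 C, 1 <= C &
    (forall x, Rabs (gamma_ratio a b x) <= C) /\
    (forall k, Rabs (gamma_ratio a b (- Z.of_nat k))
               <= C * gamma_ratio a b (Z.of_nat k)).
Proof.
  intros hb hba hbZ.
  destruct (rising_ratio_reflect_le a b hb hba hbZ) as [C HC Hle].
  pose proof (fun k => rising_ratio_pos (b + 1) (a + 1) k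
                ltac:(lra) ltac:(lra)) as Hpos.
  pose proof (fun k => rising_ratio_le_1 (b + 1) (a + 1) k
                ltac:(lra) ltac:(lra)) as Hle1.
  pose proof (Rmax_l 1 C) as Hl. pose proof (Rmax_r 1 C) as Hr.
  exists (Rmax 1 C); [exact Hl|]. split.
  - intros x. destruct (Z.leb_spec 0 x) as [Hx|Hx].
    + destruct (Z_of_nat_complete x Hx) as [k ->].
      rewrite gamma_ratio_pos. specialize (Hpos k). specialize (Hle1 k).
      rewrite Rabs_pos_eq; lra.
    + destruct (Z_of_nat_complete (- x)) as [k Hk]; [lia|].
      replace x with (- Z.of_nat k)%Z by lia. rewrite gamma_ratio_neg.
      specialize (Hle k). specialize (Hpos k). specialize (Hle1 k). nra.
  - intros k. rewrite gamma_ratio_neg, gamma_ratio_pos.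
    specialize (Hle k). specialize (Hpos k). nra.
Qed.

(** * Averaged multipliers and their total variation *)

(** The average over [N <= M] of the multipliers h (N - m) / h N with weights h N, left
    unnormalized: the weights cancel the denominators, and the total weight is the value at
    [m = 0]. *)
Definition gamma_mean (a b : R) (M m : nat) : R :=
  sum_f_R0 (fun N => gamma_ratio a b (Z.of_nat N - Z.of_nat m)) M.

Lemma gamma_mean_0 (a b : R) (M : nat) :
  gamma_mean a b M 0 = sum_f_R0 (rising_ratio (b + 1) (a + 1)) M.
Proof.
  apply sum_eq. intros N _. rewrite Z.sub_0_r. apply gamma_ratio_pos.
Qed.

(** The window of arguments, from - m to M - m, slides down by one: one value enters, one leaves. *)
Lemma gamma_mean_S (a b : R) (M m : nat) :
  gamma_mean a b M (S m) - gamma_mean a b M m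
  = gamma_ratio a b (- Z.of_nat (S m))
    - gamma_ratio a b (Z.of_nat M - Z.of_nat m).
Proof.
  unfold gamma_mean. induction M as [|M IH].
  - reflexivity.
  - cbn [sum_f_R0].
    replace (Z.of_nat (S M) - Z.of_nat (S m))%Z
      with (Z.of_nat M - Z.of_nat m)%Z by lia. lra.
Qed.

Lemma sum_f_R0_rev (f : Z -> R) (M : nat) :
  sum_f_R0 (fun m => f (Z.of_nat M - Z.of_nat m)%Z) M
  = sum_f_R0 (fun m => f (Z.of_nat m)) M.
Proof.
  induction M as [|M IH]; [reflexivity|].
  rewrite decomp_sum by lia. cbn [Nat.pred sum_f_R0].
  rewrite Z.sub_0_r, <- IH, Rplus_comm. f_equal.
  apply sum_eq. intros i _. f_equal. lia.
Qed.

Lemma sum_shift_le (f : nat -> R) (B : R) (M k : nat) :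
  (forall m, f m <= B) -> sum_f_R0 f (M + k) <= sum_f_R0 f M + B * INR k.
Proof.
  intros Hf. induction k as [|k IH].
  - rewrite Nat.add_0_r. simpl. lra.
  - rewrite Nat.add_succ_r. cbn [sum_f_R0]. specialize (Hf (S (M + k))).
    rewrite S_INR. lra.
Qed.

Lemma sum_le_sum_add (f : nat -> R) (K k : nat) :
  (forall m, 0 <= f m) -> sum_f_R0 f K <= sum_f_R0 f (K + k).
Proof.
  intros Hf. induction k as [|k IH].
  - rewrite Nat.add_0_r. lra.
  - rewrite Nat.add_succ_r. cbn [sum_f_R0]. specialize (Hf (S (K + k))). lra.
Qed.

(** Up to [M + k0], the two end values in [gamma_mean_S] are summed separately, each sum being
    comparable to the total weight. Beyond, all arguments are at most [- k0], where h is monotone of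
    fixed sign, so the variation telescopes. *)
Lemma gamma_mean_variation (a b : R) :
  0 < b -> b < a -> (~ exists z : Z, b = IZR z) ->
  exists C, forall M K,
    sum_f_R0 (fun m => Rabs (gamma_mean a b M (S m) - gamma_mean a b M m)) K
    <= C * gamma_mean a b M 0.
Proof.
  intros hb hba hbZ.
  destruct (gamma_ratio_bounded a b hb hba hbZ) as [C HC [HCb HCr]].
  destruct (rising_ratio_reflect_monotone a b hb hba)
    as [k0 [sg [Hsg Hdec]]].
  pose proof (fun k => rising_ratio_pos (b + 1) (a + 1) k
                ltac:(lra) ltac:(lra)) as Hpos.
  assert (Hmono : forall k i, (k0 <= k)%nat ->
    sg * rising_ratio (- a) (- b) (k + i) <= sg * rising_ratio (- a) (- b) k).
  { intros k i Hk. induction i as [|i IH].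
    - rewrite Nat.add_0_r. lra.
    - rewrite Nat.add_succ_r.
      destruct (Hdec (k + i)%nat ltac:(lia)). lra. }
  assert (Hsgabs : forall x, Rabs (sg * x) = Rabs x).
  { intros x. rewrite Rabs_mult.
    destruct Hsg as [-> | ->]; [rewrite Rabs_R1 | rewrite Rabs_m1]; ring. }
  (* Twice the constant of [Hinit], once for the initial range and once through the value where the
     tail starts, plus 1 for the value at 0. *)
  exists (2 * (C + 1 + 2 * C * INR k0) + 1). intros M K.
  set (V := fun m => Rabs (gamma_mean a b M (S m) - gamma_mean a b M m)).
  set (Z := gamma_mean a b M 0).
  assert (HZ1 : 1 <= Z).
  { unfold Z. rewrite gamma_mean_0.
    replace M with (0 + M)%nat by lia.
    apply Rle_trans with (sum_f_R0 (rising_ratio (b + 1) (a + 1)) 0);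
      [simpl; lra|].
    apply sum_le_sum_add. intros m. left. apply Hpos. }
  pose proof (pos_INR k0) as Hk0.
  assert (Hinit : sum_f_R0 V (M + k0) <= (C + 1 + 2 * C * INR k0) * Z).
  { assert (H1 : sum_f_R0 (fun m => Rabs (gamma_ratio a b (- Z.of_nat (S m))))
                   (M + k0) <= C * Z + C * INR k0).
    { eapply Rle_trans; [apply sum_shift_le with (B := C); intros m; apply HCb|].
      apply Rplus_le_compat_r. unfold Z. rewrite gamma_mean_0, scal_sum.
      apply sum_Rle. intros m _. eapply Rle_trans; [apply HCr|].
      rewrite gamma_ratio_pos, Rmult_comm.
      apply Rmult_le_compat_r; [lra|]. cbn [rising_ratio].
      pose proof (pos_INR m). specialize (Hpos m). apply Rle_div_l; nra. }
    assert (H2 : sum_f_R0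
        (fun m => Rabs (gamma_ratio a b (Z.of_nat M - Z.of_nat m)))
        (M + k0) <= Z + C * INR k0).
    { eapply Rle_trans; [apply sum_shift_le with (B := C); intros m; apply HCb|].
      apply Rplus_le_compat_r.
      rewrite (sum_f_R0_rev (fun x => Rabs (gamma_ratio a b x))).
      unfold Z. rewrite gamma_mean_0. apply sum_Rle. intros m _.
      rewrite gamma_ratio_pos, Rabs_pos_eq; [lra | left; apply Hpos]. }
    apply Rle_trans with (C * Z + C * INR k0 + (Z + C * INR k0)).
    - eapply Rle_trans; [|apply Rplus_le_compat; [exact H1 | exact H2]].
      rewrite <- plus_sum. apply sum_Rle. intros m _. unfold V.
      rewrite gamma_mean_S. unfold Rminus.
      eapply Rle_trans; [apply Rabs_triang|]. rewrite Rabs_Ropp. lra.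
    - assert (0 <= C * INR k0) by nra. nra. }
  assert (Hnn : forall m, (M + k0 <= m)%nat -> 0 <= sg * gamma_mean a b M m).
  { intros m Hm. unfold gamma_mean. rewrite scal_sum.
    rewrite <- (Rmult_0_l (INR (S M))), <- sum_cte.
    apply sum_Rle. intros N HN.
    replace (Z.of_nat N - Z.of_nat m)%Z with (- Z.of_nat (m - N))%Z by lia.
    rewrite gamma_ratio_neg, Rmult_comm.
    destruct (Hdec (m - N)%nat ltac:(lia)). lra. }
  assert (Htail : forall i, sum_f_R0 V (M + k0 + i)
    <= sum_f_R0 V (M + k0) + sg * gamma_mean a b M (S (M + k0))
       - sg * gamma_mean a b M (S (M + k0 + i))).
  { induction i as [|i IH]; [rewrite Nat.add_0_r; lra|].
    rewrite Nat.add_succ_r. cbn [sum_f_R0].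
    set (m := S (M + k0 + i)) in *.
    assert (HV : V m = sg * gamma_mean a b M m - sg * gamma_mean a b M (S m)).
    { unfold V. rewrite <- Hsgabs.
      assert (sg * (gamma_mean a b M (S m) - gamma_mean a b M m) <= 0).
      { rewrite gamma_mean_S.
        replace (Z.of_nat M - Z.of_nat m)%Z
          with (- Z.of_nat (m - M))%Z by lia.
        rewrite !gamma_ratio_neg.
        pose proof (Hmono (m - M)%nat (S M) ltac:(lia)) as H.
        replace (m - M + S M)%nat with (S m) in H by lia. lra. }
      rewrite Rabs_left1 by assumption. ring. }
    lra. }
  assert (HV0 : forall m, 0 <= V m) by (intros m; apply Rabs_pos).
  pose proof (sum_le_sum_add V K (M + k0) HV0) as HK.
  rewrite Nat.add_comm in HK.
  specialize (Htail K). pose proof (Hnn (S (M + k0 + K)) ltac:(lia)).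
  assert (HR : sg * gamma_mean a b M (S (M + k0)) <= Z + sum_f_R0 V (M + k0)).
  { eapply Rle_trans; [apply Rle_abs|]. rewrite Hsgabs.
    eapply Rle_trans; [apply Rabs_le_variation|]. fold Z.
    rewrite (Rabs_pos_eq Z) by lra. apply Rle_refl. }
  lra.
Qed.

(** * Cesaro weights and the Pfaff-Saalschuetz identity *)

(* The coefficients of 2F1 (d, - N; - N - b; t): those of [(1 - t) ^ (- d)]
   damped by the Cesaro weights of order [b]. *)
Fixpoint cesaro_weight (d b : R) (N j : nat) : R :=
  match j with
  | O => 1
  | S i => cesaro_weight d b N i * ((INR i + d) * (INR N - INR i))
           / (INR (S i) * (INR N + b - INR i))
  end.

Lemma cesaro_weight_nonneg (d b : R) (N j : nat) : 0 < d -> 0 < b ->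
  (j <= N)%nat -> 0 <= cesaro_weight d b N j.
Proof.
  intros Hd Hb. induction j as [|j IH]; intros Hj; cbn [cesaro_weight]; [lra|].
  pose proof (le_INR (S j) N Hj) as H. rewrite S_INR in *.
  pose proof (pos_INR j). specialize (IH ltac:(lia)).
  apply Rdiv_le_0_compat; [|apply Rmult_lt_0_compat; lra].
  apply Rmult_le_pos; [exact IH | apply Rmult_le_pos; lra].
Qed.

Lemma cesaro_weight_0 (d b : R) (N j : nat) : (N < j)%nat ->
  cesaro_weight d b N j = 0.
Proof.
  intros Hj. induction j as [|j IH]; [lia|]. cbn [cesaro_weight].
  destruct (Nat.eq_dec j N) as [->|Hne].
  - rewrite Rminus_diag_eq by reflexivity. unfold Rdiv. ring.
  - rewrite IH by lia. unfold Rdiv. ring.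
Qed.

Lemma sub_nat_not_int (b : R) (N i : nat) :
  (~ exists z : Z, b = IZR z) -> INR N + b - INR i <> 0.
Proof.
  intros hbZ H. apply hbZ. exists (Z.of_nat i - Z.of_nat N)%Z.
  rewrite minus_IZR, <- !INR_IZR_INZ. lra.
Qed.

(** Coefficient of t^m in the product of the truncation with (1 - t)^(b + d). *)
Definition cesaro_conv (d b : R) (N m : nat) : R :=
  sum_f_R0 (fun j => cesaro_weight d b N j * binc (b + d) (m - j)) m.

(* Zeilberger recurrence of the Pfaff-Saalschuetz sum, with certificate
   [- j (N + b + 1 - j) w_j c_(m + 1 - j)]. *)
Lemma cesaro_conv_rec (d b : R) (N m : nat) :
  (~ exists z : Z, b = IZR z) ->
  INR (S m) * (INR N + b - INR m) * cesaro_conv d b N (S m)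
  = (INR m - b) * (INR N + b + d - INR m) * cesaro_conv d b N m.
Proof.
  intros hbZ. unfold cesaro_conv.
  assert (Hw : forall j, INR (S j) * (INR N + b - INR j)
                           * cesaro_weight d b N (S j)
                         = (INR j + d) * (INR N - INR j)
                           * cesaro_weight d b N j).
  { intros j. cbn [cesaro_weight]. field.
    split; [apply sub_nat_not_int; exact hbZ | apply not_0_INR; lia]. }
  set (a := b + d). set (w := cesaro_weight d b N) in *.
  (* The right-hand side is the certificate at [j = k + 1], rewritten through [Hw]. At [k = m] it
     cancels the extra last term of [cesaro_conv d b N (S m)]. *)
  assert (Hpart : forall k, (k <= m)%nat ->
    INR (S m) * (INR N + b - INR m)
      * sum_f_R0 (fun j => w j * binc a (S m - j)) k
    - (INR m - b) * (INR N + b + d - INR m)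
      * sum_f_R0 (fun j => w j * binc a (m - j)) k
    = - ((INR k + d) * (INR N - INR k) * w k * binc a (m - k))).
  { intros k. induction k as [|k IH]; intros Hk.
    - cbn [sum_f_R0]. rewrite !Nat.sub_0_r. change (INR 0) with 0.
      transitivity ((INR N + b - INR m) * w O * (INR (S m) * binc a (S m))
        - (INR m - b) * (INR N + b + d - INR m) * (w O * binc a m)); [ring|].
      rewrite binc_rec. unfold a. ring.
    - cbn [sum_f_R0]. rewrite !Rmult_plus_distr_l.
      specialize (IH ltac:(lia)). rewrite <- Hw in IH.
      pose proof (binc_rec a (m - S k)) as Hb.
      replace (S (m - S k)) with (m - k)%nat in Hb by lia.
      replace (S m - S k)%nat with (m - k)%nat by lia.
      rewrite !minus_INR in Hb by lia.
      assert (Hne : INR m - INR k <> 0).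
      { rewrite <- minus_INR by lia. apply not_0_INR. lia. }
      assert (Hb' : binc a (m - k) = (INR m - INR (S k) - a) * binc a (m - S k)
                                     / (INR m - INR k)).
      { rewrite <- Hb. field. exact Hne. }
      match type of IH with ?x - ?y = ?z => replace x with (z + y) by lra end.
      rewrite Hb', !S_INR. unfold a. field. exact Hne. }
  cbn [sum_f_R0]. rewrite Rmult_plus_distr_l, Nat.sub_diag.
  specialize (Hpart m (le_n m)). rewrite Nat.sub_diag in Hpart.
  specialize (Hw m). cbn [binc] in *. lra.
Qed.

(** Both sides agree at [m = 0] and obey the same first-order recurrence in [m], whose leading
    factor is nonzero because [b] is not an integer. *)
Lemma cesaro_conv_eq (d b : R) (N m : nat) :
  0 < b -> 0 < d -> (~ exists z : Z, b = IZR z) ->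
  gamma_ratio (b + d) b (Z.of_nat N) * cesaro_conv d b N m
  = binc b m * gamma_ratio (b + d) b (Z.of_nat N - Z.of_nat m).
Proof.
  intros hb hd hbZ. induction m as [|m IH].
  - rewrite Z.sub_0_r. unfold cesaro_conv. simpl. ring.
  - pose proof (sub_nat_not_int b N m hbZ) as Hne.
    assert (HS : INR (S m) <> 0) by (apply not_0_INR; lia).
    apply (Rmult_eq_reg_l (INR (S m) * (INR N + b - INR m)));
      [|now apply Rmult_integral_contrapositive].
    pose proof (cesaro_conv_rec d b N m hbZ) as Hrec.
    pose proof (gamma_ratio_rec (b + d) b
      (Z.of_nat N - Z.of_nat (S m)) hb ltac:(lra) hbZ) as Hg.
    replace (Z.of_nat N - Z.of_nat (S m) + 1)%Z
      with (Z.of_nat N - Z.of_nat m)%Z in Hg by lia.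
    rewrite minus_IZR, <- !INR_IZR_INZ, S_INR in Hg.
    transitivity (gamma_ratio (b + d) b (Z.of_nat N)
      * (INR (S m) * (INR N + b - INR m) * cesaro_conv d b N (S m))); [ring|].
    rewrite Hrec.
    transitivity ((INR m - b) * (INR N + b + d - INR m)
      * (gamma_ratio (b + d) b (Z.of_nat N) * cesaro_conv d b N m)); [ring|].
    rewrite IH.
    transitivity (INR (S m) * binc b (S m)
      * ((INR N - (INR m + 1) + b + 1)
         * gamma_ratio (b + d) b (Z.of_nat N - Z.of_nat (S m)))); [|ring].
    rewrite Hg, binc_rec. ring.
Qed.

(** * Finite combinations of shifted series *)

(** Multiplication by t^j; it aligns the series at n + j with the one at n, so that terms with the
    same entry of [L] share an index. *)
Definition delay (j : nat) (u : nat -> R) (m : nat) : R :=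
  if (j <=? m)%nat then u (m - j)%nat else 0.

Lemma is_series_delay (j : nat) (u : nat -> R) (l : R) :
  is_series u l -> is_series (delay j u) l.
Proof.
  intros Hu. induction j as [|j IH].
  - apply (is_series_ext u); [|exact Hu].
    intros m. unfold delay. simpl. now rewrite Nat.sub_0_r.
  - apply is_series_decr_1. unfold delay at 2. simpl.
    match goal with |- is_series _ ?x =>
      replace x with l by (unfold plus, opp; simpl; ring) end.
    exact IH.
Qed.

Lemma is_series_sum_f_R0 (f : nat -> nat -> R) (l : nat -> R) (N : nat) :
  (forall j, is_series (f j) (l j)) ->
  is_series (fun m => sum_f_R0 (fun j => f j m) N) (sum_f_R0 l N).
Proof.
  intros H. induction N as [|N IH]; cbn [sum_f_R0]; [apply H|].
  apply (is_series_plus (fun m => sum_f_R0 (fun j => f j m) N)); auto.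
Qed.

Lemma sum_f_R0_trailing_0 (f : nat -> R) (k N : nat) :
  (k <= N)%nat -> (forall j, (k < j)%nat -> f j = 0) ->
  sum_f_R0 f N = sum_f_R0 f k.
Proof.
  intros Hk Hf. induction N as [|N IH].
  - now replace k with O by lia.
  - destruct (Nat.eq_dec k (S N)) as [->|Hne]; [reflexivity|].
    cbn [sum_f_R0]. rewrite IH, Hf by lia. ring.
Qed.

(** Collects the terms with [i + j = m]. The ranges [j <= N] and [j <= m] give the same sum: the
    weight vanishes for [j > N], the delay for [j > m]. *)
Lemma sum_cesaro_delay (d b : R) (N m : nat) (v : nat -> R) :
  sum_f_R0 (fun j => cesaro_weight d b N j
    * delay j (fun i => binc (b + d) i * v (i + j)%nat) m) N
  = cesaro_conv d b N m * v m.
Proof.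
  set (f := fun j => cesaro_weight d b N j
    * delay j (fun i => binc (b + d) i * v (i + j)%nat) m).
  transitivity (sum_f_R0 f (Nat.min N m)).
  { apply sum_f_R0_trailing_0; [lia|]. intros j Hj. unfold f, delay.
    destruct (Nat.leb_spec j m); [|ring].
    rewrite cesaro_weight_0 by lia. ring. }
  transitivity (sum_f_R0 f m).
  { symmetry. apply sum_f_R0_trailing_0; [lia|]. intros j Hj. unfold f, delay.
    destruct (Nat.leb_spec j m); [|ring].
    rewrite cesaro_weight_0 by lia. ring. }
  unfold cesaro_conv. rewrite Rmult_comm, scal_sum.
  apply sum_eq. intros j Hj. unfold f, delay.
  destruct (Nat.leb_spec j m); [|lia].
  replace (m - j + j)%nat with m by lia. ring.
Qed.

Lemma fracdiff_term_binc (a : R) (L : nat -> R) (n j : nat) :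
  fracdiff_term a L n j = binc a j * L (j + n)%nat.
Proof. unfold fracdiff_term. now rewrite kneg_binc. Qed.

(** The sum [s] is a nonnegative finite combination of values of (1 - nabla)^(b + d) L, so only
    finitely many convergent series are added and no infinite sums are interchanged. *)
Lemma gamma_mean_series (L : nat -> R) (d b : R) (n M : nat) :
  0 < b -> 0 < d -> (~ exists z : Z, b = IZR z) ->
  fracdiff_nonneg (b + d) L ->
  exists2 s, 0 <= s &
    is_series (fun m => gamma_mean (b + d) b M m * fracdiff_term b L n m) s.
Proof.
  intros hb hd hbZ [Hdef Hnn].
  set (t := fun N => sum_f_R0
    (fun j => cesaro_weight d b N j * fracdiff (b + d) L (j + n)) N).
  assert (Ht : forall N, is_series
    (fun m => cesaro_conv d b N m * L (m + n)%nat) (t N)).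
  { intros N.
    apply (is_series_ext (fun m => sum_f_R0 (fun j => cesaro_weight d b N j
      * delay j (fun i => binc (b + d) i * L (i + j + n)%nat) m) N)).
    { intros m. apply (sum_cesaro_delay d b N m (fun i => L (i + n)%nat)). }
    apply (is_series_sum_f_R0
      (fun j m => cesaro_weight d b N j
        * delay j (fun i => binc (b + d) i * L (i + j + n)%nat) m)).
    intros j. apply (is_series_scal (V := R_NormedModule)), is_series_delay.
    apply (is_series_ext (fracdiff_term (b + d) L (j + n))).
    - intros i. rewrite fracdiff_term_binc. now rewrite Nat.add_assoc.
    - apply Series_correct, Hdef. }
  assert (Hmu : forall N, 0 < gamma_ratio (b + d) b (Z.of_nat N)).
  { intros N. rewrite gamma_ratio_pos. apply rising_ratio_pos; lra. }
  exists (sum_f_R0 (fun N => gamma_ratio (b + d) b (Z.of_nat N) * t N) M).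
  - apply cond_pos_sum. intros N. apply Rmult_le_pos; [left; apply Hmu|].
    unfold t.
    rewrite <- (Rmult_0_l (INR (S N))), <- sum_cte.
    apply sum_Rle. intros j Hj. apply Rmult_le_pos; [|apply Hnn].
    now apply cesaro_weight_nonneg.
  - apply (is_series_ext (fun m => sum_f_R0 (fun N =>
      gamma_ratio (b + d) b (Z.of_nat N)
      * (cesaro_conv d b N m * L (m + n)%nat)) M)).
    + intros m. unfold gamma_mean. rewrite Rmult_comm, scal_sum.
      apply sum_eq. intros N _. rewrite fracdiff_term_binc.
      rewrite <- Rmult_assoc, cesaro_conv_eq by assumption. ring.
    + apply (is_series_sum_f_R0 (fun N m =>
        gamma_ratio (b + d) b (Z.of_nat N)
        * (cesaro_conv d b N m * L (m + n)%nat))).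
      intros N. apply (is_series_scal (V := R_NormedModule)), Ht.
Qed.

(** * Unit steps and the induction *)

Lemma fracdiff_nonneg_unit_step (L : nat -> R) (a b : R) :
  0 < b -> b < a -> a <= b + 1 -> (~ exists z : Z, b = IZR z) ->
  fracdiff_nonneg a L -> fracdiff_defined b L ->
  forall n, 0 <= fracdiff b L n.
Proof.
  intros hb hba hab hbZ ha hbL n.
  destruct (gamma_mean_variation a b hb hba hbZ) as [C HC].
  destruct (gamma_ratio_bounded a b hb hba hbZ) as [D HD1 [HD _]].
  (* [D + D] because each increment of [gamma_mean] is a difference of two values bounded by [D]. *)
  apply (sum_nonneg_of_means (gamma_mean a b) (fracdiff_term b L n) _ C (D + D)).
  - apply Series_correct, hbL.
  - intros M. rewrite gamma_mean_0.
    apply Rlt_le_trans with (sum_f_R0 (rising_ratio (b + 1) (a + 1)) 0);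
      [simpl; lra|].
    apply (sum_le_sum_add _ 0 M). intros m. left. apply rising_ratio_pos; lra.
  - intros E.
    destruct (sum_rising_ratio_unbounded (b + 1) (a + 1) E) as [M HM]; try lra.
    exists M. now rewrite gamma_mean_0.
  - intros M m. rewrite gamma_mean_S. unfold Rminus.
    eapply Rle_trans; [apply Rabs_triang|]. rewrite Rabs_Ropp.
    apply Rplus_le_compat; apply HD.
  - exact HC.
  - intros M. replace a with (b + (a - b)) in * by ring.
    apply gamma_mean_series; [lra | lra | exact hbZ | exact ha].
Qed.

(** By (1 - t)^(b + 1) = (1 - t)^b - t (1 - t)^b, the series at n is the one of order b at n minus
    the one at n + 1 delayed by one. *)
Lemma fracdiff_defined_succ (b : R) (L : nat -> R) :
  fracdiff_defined b L -> fracdiff_defined (b + 1) L.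
Proof.
  intros H n. destruct (H n) as [l Hl]. destruct (H (S n)) as [l' Hl'].
  exists (minus l l').
  apply (is_series_ext (fun m => fracdiff_term b L n m
                            - delay 1 (fracdiff_term b L (S n)) m)).
  2:{ apply (is_series_minus (fracdiff_term b L n)); [exact Hl|].
      apply is_series_delay. exact Hl'. }
  assert (Hc : forall j, binc (b + 1) (S j) = binc b (S j) - binc b j).
  { induction j as [|j IH].
    - simpl. field.
    - cbn [binc] in *. rewrite IH. rewrite !S_INR. pose proof (pos_INR j).
      field. lra. }
  intros [|m]; unfold delay; cbn [Nat.leb];
    rewrite !fracdiff_term_binc.
  - simpl. ring.
  - rewrite Hc. replace (S m - 1)%nat with m by lia.
    replace (m + S n)%nat with (S m + n)%nat by lia. simpl. ring.
Qed.

Theorem theorem4p4 (L : nat -> R) (a b : R)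
    (hb : 0 < b) (hba : b < a) (hbZ : ~ exists z : Z, b = IZR z)
    (ha : fracdiff_nonneg a L) (hbL : fracdiff_defined b L) :
  forall n : nat, 0 <= fracdiff b L n.
Proof.
  destruct (INR_unbounded (a - b)) as [k Hk].
  (* The induction climbs from [b]: its hypothesis at [b + 1] gives nonnegativity there, and one
     unit step brings it down to [b]; [k] bounds the remaining gap. *)
  revert b hb hba hbZ hbL Hk.
  induction k as [|k IH]; intros b hb hba hbZ hbL Hk; [simpl in Hk; lra|].
  destruct (Rle_lt_dec a (b + 1)) as [Hle|Hlt].
  - now apply (fracdiff_nonneg_unit_step L a b).
  - assert (hbZ1 : ~ exists z : Z, b + 1 = IZR z).
    { intros [z Hz]. apply hbZ. exists (z - 1)%Z. rewrite minus_IZR. lra. }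
    apply (fracdiff_nonneg_unit_step L (b + 1) b); try lra; try assumption.
    split; [now apply fracdiff_defined_succ|].
    apply IH; try lra; try assumption.
    + now apply fracdiff_defined_succ.
    + rewrite S_INR in Hk. lra.
Qed.
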